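(* Let $r \ge 1$ be an integer and let $T$ be a tournament with $\chi(T) \ge 2r$. Then $\mathrm{sm}(T) \ge r$. Moreover, for every integer $r \ge 2$ there exists a tournament $S_r$ such that $\chi(S_r) = r$ and $\mathrm{sm}(S_r) \le r - 1$.
   Context: All digraphs are finite and have no loops and no multiple edges (but both $uv$ and $vu$ may be edges). A tournament is a digraph in which every pair of distinct vertices is joined by exactly one directed edge. A set of vertices is acyclic if the subdigraph it induces contains no directed cycle. $\chi(D)$ denotes the dichromatic number of $D$: the minimum $k$ such that $V(D)$ can be partitioned into $k$ acyclic sets. A digraph is strongly-connected if for every ordered pair $(u,v)$ of vertices there is a directed path from $u$ to $v$. $\overrightarrow{K}_r$ is the digraph on $r$ vertices in which every pair of distinct vertices is joined by an edge in each direction. A digraph $D'$ is a strong $\overrightarrow{K}_r$ minor if $V(D')$ can be partitioned into $r$ non-empty sets (branch sets), each inducing a strongly-connected subdigraph, such that for any two distinct branch sets there is at least one edge in each direction between them. A digraph contains a strong $\overrightarrow{K}_r$ minor if some subdigraph of it is one. $\mathrm{sm}(D)$ is the largest $r$ such that $D$ contains a strong $\overrightarrow{K}_r$ minor. *)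

(* Defs.v *)
From HB Require Import structures.
From mathcomp Require Import all_boot.

Set Implicit Arguments.
Unset Strict Implicit.
Unset Printing Implicit Defensive.

Record digraph := Digraph {
  vertex :> finType;
  edge : rel vertex;
  edge_irr : irreflexive edge
}.

Definition tournament (D : digraph) : Prop :=
  forall u v : D, u != v -> edge u v (+) edge v u.

(* The subdigraph with vertex set W and those edges of F that are edges of D
   with both ends in W; every subdigraph of D is of this form. *)
Section Subdigraph.
Variables (D : digraph) (W : {set D}) (F : {set D * D}).

Definition sub_edge : rel {v : D | v \in W} :=
  fun u v => edge (val u) (val v) && ((val u, val v) \in F).

Lemma sub_edge_irr : irreflexive sub_edge.
Proof. by move=> u; rewrite /sub_edge edge_irr. Qed.

Definition subdigraph : digraph := Digraph sub_edge_irr.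
End Subdigraph.

Definition induced (D : digraph) (A : {set D}) : digraph :=
  subdigraph A [set: D * D].

(* The vertices of a directed cycle are distinct, so its length is at most
   #|D|; there are no loops, so a nonempty cycle has length at least 2. *)
Definition has_dicycle (D : digraph) : bool :=
  [exists c : {bseq #|D| of D}, (c != [::] :> seq D) && ucycleb (@edge D) c].

Definition acyclic (D : digraph) (A : {set D}) : bool :=
  ~~ has_dicycle (induced A).

Definition strongly_connected (D : digraph) : bool :=
  [forall u : D, forall v : D, connect (@edge D) u v].

(* [partition] has nonempty blocks; allowing empty acyclic sets would not
   change the minimum. *)
Definition acyclic_partition (D : digraph) (P : {set {set D}}) : bool :=
  partition P [set: D] && [forall A in P, acyclic A].

Definition dicolorable (D : digraph) (k : nat) : bool :=
  [exists P : {set {set D}}, acyclic_partition P && (#|P| == k)].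

Lemma acyclic1 (D : digraph) (v : D) : acyclic [set v].
Proof.
apply/existsP=> -[[c _] /= /andP[]].
have all_eq (x y : induced [set v]) : x = y.
  by apply/val_inj; rewrite (set1P (valP x)) (set1P (valP y)).
case: c => [|x [|y c]] // _ /andP[].
  by rewrite /= sub_edge_irr.
by move=> _; rewrite (all_eq y x) cons_uniq mem_head.
Qed.

Lemma dicolorable_ex (D : digraph) : exists k, dicolorable D k.
Proof.
pose P := preim_partition (@id D) [set: D].
exists #|P|; apply/existsP; exists P; rewrite eqxx andbT.
apply/andP; split; first exact: preim_partitionP.
apply/forall_inP=> _ /imsetP[v _ ->].
suff ->: [set y in [set: D] | id v == id y] = [set v] by exact: acyclic1.
by apply/setP=> y; rewrite !inE eq_sym.
Qed.

Definition dichromatic (D : digraph) : nat := ex_minn (dicolorable_ex D).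

Definition is_strong_minor (D : digraph) (r : nat) : bool :=
  [exists P : {set {set D}},
    [&& partition P [set: D], #|P| == r,
        [forall A in P, strongly_connected (induced A)] &
        [forall A in P, forall B in P, (A != B) ==>
           [exists u in A, exists v in B, edge u v]]]].

Definition has_strong_minor (D : digraph) (r : nat) : bool :=
  [exists W : {set D}, exists F : {set D * D},
     is_strong_minor (subdigraph W F) r].

Lemma has_strong_minor0 (D : digraph) : has_strong_minor D 0.
Proof.
apply/existsP; exists set0; apply/existsP; exists set0.
apply/existsP; exists set0; apply/and4P; split.
- apply/and3P; split; last by rewrite inE.
    by apply/eqP/setP=> x; have := valP x; rewrite inE.
  by apply/trivIsetP=> A B; rewrite inE.
- by rewrite cards0.
- by apply/forall_inP=> A; rewrite inE.
- by apply/forall_inP=> A; rewrite inE.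
Qed.

Lemma has_strong_minor_ex (D : digraph) : exists r, has_strong_minor D r.
Proof. by exists 0; exact: has_strong_minor0. Qed.

Lemma has_strong_minor_le (D : digraph) (r : nat) :
  has_strong_minor D r -> r <= #|D|.
Proof.
move=> /existsP[W] /existsP[F] /existsP[P] /and4P[partP /eqP<- _ _].
have -> : #|P| = \sum_(A in P) 1 by rewrite sum1_card.
apply: (@leq_trans #|subdigraph W F|); last first.
  by rewrite card_sig; exact: max_card.
rewrite -cardsT (card_partition partP); apply: leq_sum => A AP.
rewrite card_gt0; apply: contraTneq AP => ->.
by case/and3P: partP.
Qed.

Definition sm (D : digraph) : nat :=
  ex_maxn (has_strong_minor_ex D) (@has_strong_minor_le D).

(* Main.v *)
Require Import Defs.
From mathcomp Require Import all_boot.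

Set Implicit Arguments.
Unset Strict Implicit.
Unset Printing Implicit Defensive.

(** The lower bound rests on one fact about a strong tournament W
    ([dominating_core]): it contains a non-empty strong set A that is
    2-colorable and such that every vertex of W outside A has both an
    in-neighbour and an out-neighbour in A.  Given this, A is linked in both
    directions with every non-empty set disjoint from it, so it can be added to
    any family of branch sets found in W minus A, while removing A lowers the
    dichromatic number by at most 2.  A tournament that is not strong splits into
    two parts with all edges in one direction, and colorings of the parts can
    be merged without new colors; hence induction gives, for each r, either a
    coloring with 2r + 1 colors or r + 1 branch sets ([colorable_or_model]).

    To find A, let t have minimum out-degree in W and let d be the distance
    from t.  Edges increase d by at most 1, so a union of layers of the same
    parity is acyclic as soon as each layer is.  A transitive set M dominating
    the in-neighbours of t, with source s, together with a shortest path P from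
    t to s is strong and dominates all of W; picking the vertices of M greedily
    by decreasing distance ([greedy]) puts M in the layers at and beyond that of
    s, so P meets M only in s.  What may be missing is an out-neighbour of
    the set for the vertices y that are dominated by all of M and P.  These y are
    out-neighbours of t; a transitive set R absorbs them, and since t has minimum
    out-degree the sink of R has an out-neighbour z outside N^+(t), so that z -> t
    closes R up into a strong set ([min_outdegree]).  When d(s) > 2, layer 1
    consists of R and a vertex dominating it, the layers from d(s) on of vertices
    of M, and every other layer of at most one vertex of P and possibly z; so
    coloring by the parity of d works.  When d(s) = 2, the set M, t, R is one
    class, and z with the middle vertex of P the other.

    For the second claim take the tower of tournaments T_0 = one vertex,
    T_(n+1) = the directed triangle with two of its vertices replaced by copies of
    T_n.  With n + 1 colors on T_(n+1), the color of the apex would be absent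
    from one of the copies, as a color in both gives a monochromatic triangle; so
    each step raises the dichromatic number by exactly 1.  A strong set avoiding
    the apex lies in one copy, and two such sets in different copies are joined
    in one direction only; so at most one branch set is not inside one
    common copy of T_n, and each step raises the number of branch sets by at most
    1.  For T_1, the directed triangle, there is no model with two branch sets,
    which is where the number of branch sets falls behind. *)

(** * Acyclic sets, strong sets, colorings and models of a relation *)
Section Relations.
Variables (V : finType) (e : rel V).
Implicit Types (A B U W : {set V}).

(** For finite digraphs without loops, having a source in every non-empty subset
    is equivalent to having no directed cycle; this form combines well under
    unions and layerings. *)
Definition acyc A := forall U, U \subset A -> U != set0 ->
  exists2 u, u \in U & forall v, v \in U -> ~~ e v u.

Definition closed_in A U := [forall u in U, forall v in A, e u v ==> (v \in U)].

Lemma closed_inP A U :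
  reflect (forall u v, u \in U -> v \in A -> e u v -> v \in U) (closed_in A U).
Proof.
apply: (iffP forall_inP) => [H u v uU vA|H u uU].
  by move/forall_inP: (H u uU) => /(_ v vA)/implyP.
by apply/forall_inP=> v vA; apply/implyP; apply: H uU vA.
Qed.

(** Strong connectivity as the absence of a proper non-empty set that no edge
    leaves, which avoids handling paths. *)
Definition strong A := forall U, U \subset A -> U != set0 -> closed_in A U ->
  A \subset U.

(** [k] colors with possibly empty classes, relative to a subset of the
    vertices. *)
Definition colorable k A := exists2 c : V -> nat, (forall v, v \in A -> c v < k) &
  forall n, acyc [set v in A | c v == n].

(** [P] is the family of branch sets of a strong complete minor; the edge
    condition ranges over ordered pairs, so it gives both directions. *)
Definition model (P : {set {set V}}) := forall A, A \in P ->
  [/\ A != set0, strong A & forall B, B \in P -> A != B ->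
      [disjoint A & B] /\ exists u v, [/\ u \in A, v \in B & e u v]].

Lemma acyc_sub A B : A \subset B -> acyc B -> acyc A.
Proof. by move=> sAB acB U sUA; apply: acB; apply: subset_trans sAB. Qed.

(** In a non-empty subset, no edge enters the topmost non-empty layer from
    another layer, so a source of that layer is a source of the subset. *)
Lemma acyc_layers (f : V -> nat) A :
    (forall u v, u \in A -> v \in A -> e u v -> f v <= f u) ->
    (forall n, acyc [set v in A | f v == n]) -> acyc A.
Proof.
move=> mono lay U sUA /set0Pn[x xU].
case: (arg_maxnP f xU) => w wU wmax.
have [||u] := lay (f w) [set v in U | f v == f w].
- by apply/subsetP=> v; rewrite !inE => /andP[/(subsetP sUA)-> ->].
- by apply/set0Pn; exists w; rewrite inE eqxx andbT.
rewrite inE => /andP[uU /eqP fu] umin; exists u => // v vU.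
apply/negP=> evu; have := umin v; rewrite inE vU evu /= => H.
suff: f v == f w by move/H.
by rewrite eqn_leq [_ <= _]wmax // -fu mono ?(subsetP sUA).
Qed.

Lemma acyc_setU A B : (forall u v, u \in A -> v \in B -> ~~ e u v) ->
  acyc A -> acyc B -> acyc (A :|: B).
Proof.
move=> noAB acA acB.
apply: (@acyc_layers (fun v => v \in B)) => [u v|[|n]].
- rewrite !inE => /orP[uA|->]; last by rewrite leq_b1.
  by case: (boolP (v \in B)) => // vB _; rewrite (negPf (noAB _ _ uA vB)).
- apply: acyc_sub acA; apply/subsetP=> v; rewrite !inE.
  by case: (v \in B); rewrite ?andbF // orbF => /andP[].
- apply: acyc_sub acB; apply/subsetP=> v; rewrite !inE.
  by case: (v \in B); rewrite ?andbF.
Qed.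

Lemma colorable_setU j k A B : colorable j A -> colorable k B -> colorable (j + k) (A :|: B).
Proof.
move=> [a aj aA] [b bk bB].
exists (fun v => if v \in A then a v else j + b v) => [v|n].
  rewrite inE; case: ifP => [vA _|_ /= /bk]; last by rewrite ltn_add2l.
  exact: ltn_addr (aj _ vA).
case: (ltnP n j) => nj.
  apply: acyc_sub (aA n); apply/subsetP=> v; rewrite !inE.
  case: (v \in A) => //= /andP[_ /eqP E]; move: nj; rewrite -E.
  by rewrite ltnNge leq_addr.
apply: acyc_sub (bB (n - j)); apply/subsetP=> v; rewrite !inE.
case: ifP => [vA /eqP E|_ /andP[/= -> /eqP<-]]; last by rewrite addKn eqxx.
by move: nj; rewrite -E leqNgt aj.
Qed.

(** Both parts can use the same colors, as no directed cycle meets both. *)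
Lemma colorable_split k A B : (forall u v, u \in A -> v \in B -> ~~ e u v) ->
  colorable k A -> colorable k B -> colorable k (A :|: B).
Proof.
move=> noAB [a ak aA] [b bk bB].
exists (fun v => if v \in B then b v else a v) => [v|n].
  by rewrite inE; case: ifP => [/bk//|_]; rewrite orbF => /ak.
apply: (@acyc_sub _ ([set v in A | a v == n] :|: [set v in B | b v == n])).
  apply/subsetP=> v; rewrite !inE.
  by case: (v \in B) => [/andP[_ ->]|/=]; rewrite ?orbT // !orbF.
apply: acyc_setU => // u v; rewrite !inE => /andP[uA _] /andP[vB _].
exact: noAB.
Qed.

End Relations.

(** A source of the subset is not the head of any of its edges, so a sink of what
    remains after deleting it is a sink of the subset. *)
Lemma acyc_rev (V : finType) (e : rel V) (A : {set V}) :
  irreflexive e -> acyc e A -> acyc (fun u v => e v u) A.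
Proof.
move=> irr acA U; have [n] := ubnP #|U|; elim: n U => // n IHn U.
rewrite ltnS => leUn sUA U0.
have [u uU umin] := acA U sUA U0.
have [U1|U1] := eqVneq (U :\ u) set0.
  exists u => // v vU; have [->|vu] := eqVneq v u; first by rewrite irr.
  by have := in_set0 v; rewrite -U1 !inE vu vU.
have [||w wU wmin] := IHn _ _ _ U1.
- by apply: leq_trans leUn; rewrite [leqRHS](cardsD1 u) uU.
- exact: subset_trans (subsetDl _ _) sUA.
have wU' := subsetP (subsetDl _ _) _ wU.
exists w => // v vU; have [->|vu] := eqVneq v u; first exact: umin.
by apply: wmin; rewrite !inE vu.
Qed.

Definition tournament_rel (V : finType) (e : rel V) :=
  irreflexive e /\ forall u v, u != v -> e u v (+) e v u.

Lemma acyc1 (V : finType) (e : rel V) x : irreflexive e -> acyc e [set x].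
Proof.
move=> irr U; rewrite subset1 => /orP[]/eqP->; last by rewrite eqxx.
by move=> _; exists x; rewrite ?inE // => v /set1P->; rewrite irr.
Qed.

Lemma acyc2 (V : finType) (e : rel V) x y :
  tournament_rel e -> acyc e [set x; y].
Proof.
move=> [irr tot].
have [<-|xy] := eqVneq x y; first by rewrite setUid; apply: acyc1.
wlog exy : x y xy / e x y.
  move=> H; have := tot x y xy; case exy: (e x y); first by move=> _; apply: H.
  by move=> /= eyx; rewrite setUC; apply: H; rewrite 1?eq_sym.
rewrite setUC; apply: acyc_setU; [|exact: acyc1..] => u v /set1P-> /set1P->.
by have := tot x y xy; rewrite exy.
Qed.

(** [M] is a transitive dominating set of [C], obtained by repeatedly taking a
    vertex with [f] maximal and continuing in its in-neighbourhood: the last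
    vertex taken is the source [s], and since the candidates only decrease, it
    has the smallest value of [f].  Applied to the reversed relation this gives
    an absorbing set with a sink. *)
Lemma greedy (V : finType) (e : rel V) (f : V -> nat) (C : {set V}) :
    tournament_rel e -> C != set0 ->
  exists M : {set V}, exists2 s, s \in M &
  [/\ M \subset C, acyc e M,
      forall m, m \in M -> f s <= f m /\ (m != s -> e s m) &
      forall x, x \in C -> x \notin M -> exists2 m, m \in M & e m x].
Proof.
move=> te; have [irr tot] := te.
have [n] := ubnP #|C|; elim: n C => // n IHn C; rewrite ltnS => leCn /set0Pn[x0 x0C].
case: (arg_maxnP f x0C) => x; rewrite -[_ x]/(x \in C) => xC xmax.
pose C' := [set y in C | e y x].
have sC'C : C' \subset C by apply/subsetP=> y; rewrite inE => /andP[].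
have dom y : y \in C -> y != x -> y \notin C' -> e x y.
  move=> yC yx; rewrite inE yC /= => nyx.
  by have := tot y x yx; rewrite (negPf nyx).
have [C'0|C'0] := eqVneq C' set0.
  exists [set x]; exists x; rewrite ?inE //; split=> [||m|y yC].
  - by rewrite sub1set.
  - exact: acyc1.
  - by move/set1P=> ->; rewrite eqxx.
  - by rewrite inE => yx; exists x; rewrite ?inE // dom // C'0 inE.
have [|M [s sM [sMC' acM srcM domM]]] := IHn C' _ C'0.
  apply: leq_trans leCn; apply: proper_card; rewrite properE sC'C.
  by apply/subsetPn; exists x => //; rewrite inE irr andbF.
have toX m : m \in M -> e m x by move/(subsetP sMC'); rewrite inE => /andP[].
have noX m : m \in M -> ~~ e x m.
  move=> mM; have mx: m != x by apply: contraTneq (toX m mM) => ->; rewrite irr.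
  by have := tot m x mx; rewrite toX.
exists (x |: M); exists s; first by rewrite !inE sM orbT.
split=> [||m|y yC].
- by rewrite subUset sub1set xC (subset_trans sMC').
- apply: acyc_setU acM; [move=> u v /set1P->; exact: noX | exact: acyc1].
- rewrite !inE => /orP[/eqP->|/srcM//]; split; last by rewrite toX.
  by apply: xmax; apply: (subsetP sC'C); apply: (subsetP sMC').
- rewrite !inE negb_or => /andP[yx yM].
  have [yC'|yC'] := boolP (y \in C').
    by have [m mM emy] := domM y yC' yM; exists m; rewrite // !inE mM orbT.
  by exists x; rewrite ?inE ?eqxx // dom.
Qed.

(** * Distances from a vertex of a strong set *)
Section Distance.
Variables (V : finType) (e : rel V) (W : {set V}) (t : V).
Hypotheses (tW : t \in W) (sW : strong e W).

(** The distance function is characterized by the properties used later: it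
    grows by at most 1 along an edge, and each positive value is reached from a
    vertex one step closer. *)
Lemma distance : exists d : V -> nat,
  [/\ d t = 0, forall v, v \in W -> d v = 0 -> v = t,
      forall u v, u \in W -> v \in W -> e u v -> d v <= (d u).+1 &
      forall v, v \in W -> 0 < d v ->
        exists u, [/\ u \in W, e u v & d v = (d u).+1]].
Proof.
pose eW : rel V := fun u v => e u v && (v \in W).
pose walk n v := [exists p : n.-tuple V, path eW t p && (last t p == v)].
have walkP n v : reflect (exists2 p, path eW t p & last t p = v /\ size p = n) (walk n v).
  apply: (iffP existsP) => [[p /andP[pp /eqP lp]]|[p pp [lp sp]]].
    by exists p; rewrite // size_tuple.
  by move/eqP: sp => sp; exists (Tuple sp); rewrite /= pp lp eqxx.
have reach v : v \in W -> exists n, walk n v.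
  have cl : closed_in e W [set v in W | connect eW t v].
    apply/closed_inP=> x y; rewrite !inE => /andP[_ cx] yW exy; rewrite yW /=.
    by apply: connect_trans cx (connect1 _); rewrite /eW exy.
  have /(_ _ _ cl)/subsetP sub := @sW [set v in W | connect eW t v].
  move=> vW; have: v \in [set v in W | connect eW t v].
    apply: sub vW; first by apply/subsetP=> x; rewrite inE => /andP[].
    by apply/set0Pn; exists t; rewrite inE tW connect0.
  rewrite inE => /andP[_ /connectP[p pp lp]].
  by exists (size p); apply/walkP; exists p.
have /fin_all_exists[d dP] v : exists n, v \in W ->
    walk n v /\ forall m, walk m v -> n <= m.
  have [vW|vW] := boolP (v \in W); last by exists 0.
  by case: (ex_minnP (reach v vW)) => n nP nmin; exists n.
have step u v : u \in W -> v \in W -> e u v -> d v <= (d u).+1.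
  move=> uW vW euv; apply: (dP v vW).2; have [/walkP[p pp [lp sp]] _] := dP u uW.
  apply/walkP; exists (rcons p v); last by rewrite last_rcons size_rcons sp.
  by rewrite rcons_path pp lp /eW euv.
exists d; split=> // [|v vW dv|v vW dv].
- by apply/eqP; rewrite -leqn0; apply: (dP t tW).2; apply/walkP; exists [::].
- have [/walkP[p _ [lp sp]] _] := dP v vW.
  by rewrite -lp (size0nil (etrans sp dv)).
- have [/walkP[p + +] _] := dP v vW.
  case/lastP: p => [_ [_ /= d0]|p w]; first by rewrite -d0 in dv.
  rewrite rcons_path last_rcons size_rcons => /andP[pp /andP[euv _]] [wv sp].
  rewrite wv in euv.
  have uW : last t p \in W.
    case/lastP: p pp {sp euv} => //= p u; rewrite rcons_path last_rcons.
    by case/and3P.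
  exists (last t p); split=> //; apply/eqP.
  rewrite eqn_leq step // andTb -sp ltnS; apply: (dP _ uW).2.
  by apply/walkP; exists p.
Qed.

Lemma geodesic (d : V -> nat) :
    (forall v, v \in W -> d v = 0 -> v = t) ->
    (forall v, v \in W -> 0 < d v ->
        exists u, [/\ u \in W, e u v & d v = (d u).+1]) ->
  forall s, s \in W -> exists p : nat -> V,
  [/\ p 0 = t, p (d s) = s, forall i, i <= d s -> p i \in W /\ d (p i) = i &
      forall i, i < d s -> e (p i) (p i.+1)].
Proof.
move=> d0 dS s; move: {2}(d s) (erefl (d s)) => n; elim: n s => [|n IHn] s ds sW'.
  exists (fun=> s); rewrite ds; split=> //; first exact: d0.
  by move=> i; rewrite leqn0 => /eqP->.
have [|u [uW eus]] := dS s sW'; first by rewrite ds.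
rewrite ds => -[/esym du].
have [p [p0 pu pW pe]] := IHn u du uW; rewrite du in pu pW pe.
exists (fun i => if i <= n then p i else s); rewrite ltnn; split=> // i.
  rewrite leq_eqVlt ltnS => /orP[/eqP->|le_in]; first by rewrite ltnn.
  by rewrite le_in; apply: pW.
rewrite ltnS; case: ltngtP => // [lt_in|->] _; last by rewrite pu.
exact: pe.
Qed.

(** Otherwise N^+(y) would be contained in N^+(t) minus [y], which is smaller
    than N^+(t). *)
Lemma min_outdegree : tournament_rel e ->
  (forall v, v \in W -> #|[set x in W | e t x]| <= #|[set x in W | e v x]|) ->
  forall y, y \in W -> e t y -> exists z, [/\ z \in W, e y z, e z t & z != t].
Proof.
move=> [irr tot] tmin y yW ety.
have: ~~ ([set x in W | e y x] \subset [set x in W | e t x]).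
  apply/negP=> sub; have := tmin y yW; rewrite leqNgt; case/negP.
  apply: proper_card; rewrite properE sub; apply/subsetPn.
  by exists y; rewrite !inE ?yW ?irr.
case/subsetPn=> z; rewrite !inE => /andP[zW eyz]; rewrite zW /= => netz.
have yt : t != y by apply: contraTneq ety => ->; rewrite irr.
have zt : z != t.
  by apply: contraTneq eyz => ->; have := tot t y yt; rewrite ety.
by exists z; split=> //; have := tot z t zt; rewrite (negPf netz) addbF.
Qed.
End Distance.

(** * A strong 2-colorable set dominating a strong tournament both ways *)
Section Core.
Variables (V : finType) (e : rel V).
Hypothesis te : tournament_rel e.

(** Between layers of equal parity, edges can only go towards smaller values of
    [d]. *)
Lemma colorable2_parity (d : V -> nat) (A : {set V}) :
    (forall u v, u \in A -> v \in A -> e u v -> d v <= (d u).+1) ->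
    (forall n, acyc e [set v in A | d v == n]) -> colorable e 2 A.
Proof.
move=> dS lay; exists (fun v => odd (d v)) => [v _|n]; first by case: odd.
apply: (acyc_layers (f := d)) => [u v|m].
  rewrite !inE => /andP[uA /eqP ou] /andP[vA /eqP ov] euv.
  have := dS _ _ uA vA euv; rewrite leq_eqVlt ltnS => /orP[/eqP duv|//].
  by move: ov; rewrite -ou duv /=; case: odd.
apply: acyc_sub (lay m); apply/subsetP=> v; rewrite !inE.
by case/andP=> /andP[-> _] ->.
Qed.

(** Two colors suffice for the union of M, P, R and z although each of M and R
    can be large: M lies where P ends, and all of M and P points to R. *)
Lemma dominating_core (W : {set V}) : strong e W -> W != set0 ->
  exists A : {set V}, [/\ A \subset W, A != set0, strong e A, colorable e 2 A &
    forall x, x \in W -> x \notin A ->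
      (exists2 a, a \in A & e a x) /\ (exists2 a, a \in A & e x a)].
Proof.
move=> sW W0; have [irr tot] := te; have /set0Pn[t0 t0W] := W0.
pose outdeg v := #|[set x in W | e v x]|.
case: (arg_minnP outdeg t0W) => t; rewrite -[_ t]/(t \in W) => tW tmin.
pose C := [set x in W | e x t].
have toNt x : e x t -> ~~ e t x.
  move=> ext; have xt : x != t by apply: contraTneq ext => ->; rewrite irr.
  by have := tot x t xt; rewrite ext.
have outT x : x \in W -> x != t -> x \notin C -> e t x.
  by move=> xW xt; rewrite inE xW /= => next; have := tot x t xt; rewrite (negPf next).
(* A strong set with no edge into t is reduced to t. *)
have [C0|C0] := eqVneq C set0.
  have subt : W \subset [set t].
    apply/negPn/negP=> /subsetPn[x xW]; rewrite inE => xt.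
    have cl : closed_in e W (W :\ t).
      apply/closed_inP=> u v; rewrite !inE => /andP[ut uW] vW euv.
      rewrite vW andbT; apply/eqP=> vt; rewrite vt in euv.
      by have := in_set0 u; rewrite -C0 inE uW euv.
    have Wt0 : W :\ t != set0 by apply/set0Pn; exists x; rewrite !inE xt.
    have := subsetP (sW _ (subsetDl _ _) Wt0 cl) t tW.
    by rewrite !inE eqxx.
  exists W; split=> // [|x ->//].
  exists (fun=> 0) => // n; apply: acyc_sub (@acyc1 _ e t irr).
  by apply: subset_trans subt; apply/subsetP=> v; rewrite inE => /andP[].
have [d [dt d0 dS dP]] := distance tW sW.
have out1 x : x \in W -> e t x -> d x = 1.
  move=> xW etx; have := dS t x tW xW etx; rewrite dt.
  case dx: (d x) => [|[|]] // _.
  by move: etx; rewrite (d0 x xW dx) irr.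
have dC x : x \in C -> 1 < d x.
  rewrite inE => /andP[xW ext]; case dx: (d x) => [|[|n]] //.
    by move: ext; rewrite (d0 x xW dx) irr.
  have [|u [uW eux]] := dP x xW; first by rewrite dx.
  rewrite dx => -[/esym du]; move: eux; rewrite (d0 u uW du).
  by rewrite (negPf (toNt x ext)).
have Cd x : x \in W -> 1 < d x -> x \in C.
  move=> xW dx; apply: contraLR dx => xC; have [->|xt] := eqVneq x t.
    by rewrite dt.
  by rewrite (out1 x xW) // outT.
have [M [s sM [sMC acM srcM domM]]] := greedy d te C0.
have MC x : x \in M -> x \in C by apply/subsetP.
have CW x : x \in C -> x \in W by rewrite inE => /andP[].
have Ct x : x \in C -> e x t by rewrite inE => /andP[].
have sW' := CW s (MC s sM); have ds := dC s (MC s sM).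
have [p [p0 ps pW pe]] := geodesic d0 dP sW'.
pose P := [set p (i : 'I_(d s).+1) | i in 'I_(d s).+1].
have PP x : reflect (exists2 i, i <= d s & x = p i) (x \in P).
  apply: (iffP imsetP) => [[i _ ->]|[i li ->]].
    by exists i => //; rewrite -ltnS.
  by exists (Ordinal (li : i < (d s).+1)).
pose A0 := M :|: P.
have MA0 x : x \in M -> x \in A0 by rewrite inE => ->.
have PA0 i : i <= d s -> p i \in A0.
  by move=> li; rewrite inE; apply/orP; right; apply/PP; exists i.
have A0W x : x \in A0 -> x \in W.
  by rewrite inE => /orP[/MC/CW//|/PP[i li ->]]; case: (pW i li).
have tA0 : t \in A0 by rewrite -p0; apply: PA0.
(* Y consists of the vertices that lack an out-neighbour in the union of M and
   P. *)
pose Y := [set y in W | [forall a in A0, e a y]].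
have YW y : y \in Y -> y \in W by rewrite inE => /andP[].
have Y_in y a : y \in Y -> a \in A0 -> e a y.
  by rewrite inE => /andP[_ /forall_inP]; apply.
have [R [z [sRY acR domR [zW zt dz] [Rz zR]]]] : exists (R : {set V}) (z : V),
  [/\ R \subset Y, acyc e R,
      forall y, y \in Y -> y \notin R -> exists2 r, r \in R & e y r,
      [/\ z \in W, e z t & d z = 2] &
      (forall y, y \in R -> e y z \/ exists y', [/\ y' \in R, e y y' & e y' z]) /\
      (z \in A0 \/ exists2 y, y \in R & e y z)].
  (* With nothing to absorb, z can be any vertex of A0 in layer 2. *)
  have [Y0|Y0] := eqVneq Y set0.
    have [p2W dp2] := pW 2 ds.
    exists set0, (p 2); split=> [||y|//|].
    - by rewrite Y0.
    - by move=> U; rewrite subset0 => /eqP->; rewrite eqxx.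
    - by rewrite Y0 inE.
    - by split=> //; apply: Ct; apply: Cd; rewrite ?dp2.
    - by split=> [y|]; [rewrite inE | left; apply: PA0].
  have te' : tournament_rel (fun u v => e v u).
    by split=> [u|u v uv]; [exact: irr | rewrite addbC; apply: tot].
  have [R [y0 y0R [sRY acR snkR domR]]] := greedy (fun=> 0) te' Y0.
  have y0Y := subsetP sRY _ y0R.
  have [//|z [zW y0z zt _]] := min_outdegree te tmin (YW _ y0Y).
    by apply: Y_in.
  exists R, z; split=> //.
  - exact: (acyc_rev (e := fun u v => e v u)) acR.
  - split=> //; apply/eqP; rewrite eqn_leq dC ?inE ?zW // andbT.
    by rewrite -(out1 y0) ?dS // ?YW // Y_in.
  - split=> [y yR|]; last by right; exists y0.
    have [->|yy0] := eqVneq y y0; first by left.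
    by right; exists y0; split=> //; apply: (snkR y yR).2.
have zC : z \in C by rewrite inE zW.
have RY y : y \in R -> y \in Y by apply/subsetP.
have R1 y : y \in R -> d y = 1.
  by move=> /RY yY; rewrite out1 ?YW // Y_in.
pose A := A0 :|: R :|: [set z].
have A0A x : x \in A0 -> x \in A by rewrite !inE => ->.
have RA x : x \in R -> x \in A by rewrite !inE => ->; rewrite !orbT.
have zA : z \in A by rewrite !inE eqxx orbT.
have AW x : x \in A -> x \in W.
  by rewrite !inE -in_setU => /orP[/orP[/A0W|/RY/YW]|/eqP->].
exists A; split.
- by apply/subsetP.
- by apply/set0Pn; exists z.
- move=> U sUA /set0Pn[u uU] /closed_inP cl.
  have CU x : x \in C -> x \in U -> t \in U.
    by move=> xC xU; apply: cl xU _ (Ct x xC); apply: A0A.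
  have zU : z \in U -> t \in U by apply: CU.
  (* Every vertex of A has a walk to t: in-neighbours of t directly, p 1 through
     p 2, and R through its sink and z. *)
  have tU : t \in U.
    have: u \in A by apply: (subsetP sUA).
    rewrite !inE -!orbA => /or4P[/MC uC|/PP[i li ui]|uR|/eqP uz].
    + exact: CU uC uU.
    + rewrite {}ui in uU; have [pWi dpi] := pW i li.
      case: i li uU pWi dpi => [|[|i]] li uU pWi dpi; first by rewrite -p0.
        apply: (CU (p 2)); first by apply: Cd; case: (pW 2 ds) => // _ ->.
        by apply: cl uU _ (pe 1 ds); apply/A0A/PA0.
      by apply: CU uU; apply: Cd; rewrite ?dpi.
    + have [euz|[y [yR uy yz]]] := Rz u uR; apply: zU.
        exact: cl uU zA euz.
      by apply: (cl y) => //; apply: cl uU _ uy; apply: RA.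
    + by apply: zU; rewrite -uz.
  (* Conversely t reaches P, hence s, hence M; it dominates R, whose sink gives
     z. *)
  have pU i : i <= d s -> p i \in U.
    elim: i => [|i IHi] li; first by rewrite p0.
    by apply: cl (IHi (ltnW li)) _ (pe i li); apply/A0A/PA0.
  have sU : s \in U by rewrite -ps pU.
  have A0U x : x \in A0 -> x \in U.
    move=> xA0; move: (xA0); rewrite inE => /orP[xM|/PP[i li ->]]; last exact: pU.
    have [->//|xs] := eqVneq x s.
    by apply: cl sU _ ((srcM x xM).2 xs); apply: A0A.
  have RU x : x \in R -> x \in U.
    by move=> xR; apply: cl tU (RA x xR) _; apply: Y_in (RY x xR) tA0.
  apply/subsetP=> x; rewrite !inE -in_setU => /orP[/orP[/A0U|/RU]|/eqP->] //.
  case: zR => [/A0U//|[y yR yz]]; exact: cl (RU y yR) zA yz.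
- have RnotA0 y a : y \in R -> a \in A0 -> ~~ e y a.
    move=> yR aA0; have eay := Y_in y a (RY y yR) aA0.
    have ay : a != y by apply: contraTneq eay => ->; rewrite irr.
    by have := tot a y ay; rewrite eay.
  move: ds; rewrite leq_eqVlt => /orP[/eqP ds2|ds3].
    (* If d s = 2, layer 2 may contain M and z together, so parity may fail; but P
       has a single inner vertex p 1, and M, t, R are stacked in this order. *)
    exists (fun v => v \notin R :|: [set t] :|: M) => [v _|n]; first by case: (_ \notin _).
    case: n => [|n].
      apply: (@acyc_sub _ _ _ (R :|: [set t] :|: M)).
        by apply/subsetP=> v; rewrite inE => /andP[_]; rewrite eqb0 negbK.
      apply: acyc_setU => //.
        move=> u v; rewrite 2!inE => /orP[uR|/eqP-> vM].
          by move=> vM; apply: RnotA0 (MA0 _ vM).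
        by apply/toNt/Ct/MC.
      apply: acyc_setU => //; last exact: acyc1.
      by move=> u v uR /set1P->; apply: RnotA0.
    apply: acyc_sub (@acyc2 _ e (p 1) z te); apply/subsetP=> v.
    rewrite inE => /andP[vA]; case vn: (v \notin _) => // _.
    move: vn vA; rewrite !inE !negb_or => /andP[/andP[vR vt] vM].
    rewrite (negPf vR) (negPf vM) orbF /= => /orP[/PP[i li vi]|->]; last by rewrite orbT.
    case: i li vi => [|[|[|i]]] li vi; last by rewrite -ds2 in li.
    - by rewrite vi p0 eqxx in vt.
    - by rewrite vi eqxx.
    - by rewrite vi ds2 ps sM in vM.
  apply: (@colorable2_parity d) => [u v /AW uW /AW vW|n]; first exact: dS.
  (* Below layer d s there is no vertex of M, and from layer d s on only vertices
     of M, because z lies in layer 2. *)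
  have [nds|nds] := ltnP n (d s).
    have [n1|n1] := eqVneq n 1.
      apply: (@acyc_sub _ _ _ (R :|: [set p 1])).
        apply/subsetP=> v; rewrite !inE -!orbA => /andP[+ /eqP dv].
        case/or4P=> [vM|/PP[i li vi]|->|/eqP vz] //.
        - by have := (srcM v vM).1; rewrite dv leqNgt nds.
        - by move: dv; rewrite vi (pW i li).2 n1 => ->; rewrite eqxx orbT.
        - by move: dv; rewrite vz dz n1.
      apply: acyc_setU => //; last exact: acyc1.
      by move=> u v uR /set1P->; apply: RnotA0 (PA0 1 (ltnW (ltnW ds3))).
    apply: acyc_sub (@acyc2 _ e (p n) z te).
    apply/subsetP=> v; rewrite !inE -!orbA => /andP[+ /eqP dv].
    case/or4P=> [vM|/PP[i li vi]|vR|->]; rewrite ?orbT //.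
    - by have := (srcM v vM).1; rewrite dv leqNgt nds.
    - by move: dv; rewrite vi (pW i li).2 => ->; rewrite eqxx.
    - by move: n1; rewrite -dv (R1 v vR).
  apply: acyc_sub acM; apply/subsetP=> v; rewrite !inE -!orbA => /andP[+ /eqP dv].
  case/or4P=> [//|/PP[i li vi]|vR|/eqP vz].
  - suff di : i = d s by rewrite vi di ps.
    by apply/eqP; rewrite eqn_leq li; move: nds; rewrite -dv vi (pW i li).2.
  - by move: nds; rewrite -dv (R1 v vR) leqNgt (ltnW ds3).
  - by move: nds; rewrite -dv vz dz leqNgt ds3.
- move=> x xW xA; split.
    have [xC|xC] := boolP (x \in C).
      have [|m mM emx] := domM x xC; last by exists m => //; apply/A0A/MA0.
      by apply: contra xA => /MA0/A0A.
    by exists t; [apply: A0A | apply: outT => //; apply: contraNneq xA => ->; apply: A0A].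
  have [xY|] := boolP (x \in Y).
    have [|r rR exr] := domR x xY; last by exists r => //; apply: RA.
    by apply: contra xA => /RA.
  rewrite inE xW /= => /forall_inPn[a aA0 neax]; exists a; first exact: A0A.
  have ax : a != x by apply: contraNneq xA => <-; apply: A0A.
  by have := tot a x ax; rewrite (negPf neax).
Qed.
End Core.

(** * Colorings or models by induction *)
Section ColoringOrModel.
Variables (V : finType) (e : rel V).
Implicit Types (U W : {set V}).

(** A set that is not strong splits along a closed subset, and colorings of the
    two parts merge without extra colors. *)
Lemma colorable_strong_ind k (Q : {set V} -> Prop) :
    (forall U W, U \subset W -> Q U -> Q W) ->
    (forall W, strong e W -> W != set0 -> colorable e k W \/ Q W) ->
  forall W, colorable e k W \/ Q W.
Proof.
move=> Qmono base W; have [n] := ubnP #|W|; elim: n W => // n IHn W.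
rewrite ltnS => leWn.
have [/existsP[U /and4P[sUW U0 WnU cl]]|nocl] := boolP [exists U : {set V},
  [&& U \subset W, U != set0, ~~ (W \subset U) & closed_in e W U]].
  have ltU : #|U| < n.
    by apply: leq_trans leWn; apply: proper_card; rewrite properE sUW.
  have ltD : #|W :\: U| < n.
    apply: leq_trans leWn; rewrite -(cardsID U W) (setIidPr sUW).
    by rewrite -[_.+1]add1n leq_add2r card_gt0.
  have [cU|] := IHn U ltU; last by move=> QU; right; apply: Qmono sUW QU.
  have [cD|] := IHn _ ltD; last by move=> QD; right; apply: Qmono (subsetDl _ _) QD.
  left; have -> : W = U :|: W :\: U by rewrite setDE setUIr setUCr setIT (setUidPr sUW).
  apply: colorable_split => // u v uU; rewrite !inE => /andP[vU vW].
  by apply: contra vU; apply: (closed_inP _ _ _ cl).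
have sW : strong e W.
  move=> U sUW U0 cl; apply: contraNT nocl => nWU.
  by apply/existsP; exists U; rewrite sUW U0 nWU.
have [W0|W0] := eqVneq W set0; last exact: base.
left; exists (fun=> 0) => [v|n']; first by rewrite W0 inE.
by move=> U; rewrite W0 => /subsetP sU /set0Pn[u /sU]; rewrite !inE.
Qed.

Definition model_in r W := exists P : {set {set V}},
  [/\ model e P, #|P| = r & forall A, A \in P -> A \subset W].

Lemma model_in_sub r U W : U \subset W -> model_in r U -> model_in r W.
Proof.
move=> sUW [P [mP cP PU]]; exists P; split=> // A /PU sAU.
exact: subset_trans sUW.
Qed.

Lemma model_in_add r (A W : {set V}) : A \subset W -> A != set0 -> strong e A ->
    (forall x, x \in W -> x \notin A ->
      (exists2 a, a \in A & e a x) /\ (exists2 a, a \in A & e x a)) ->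
  model_in r (W :\: A) -> model_in r.+1 W.
Proof.
move=> sAW A0 sA dA [P [mP cP PW]].
have disj B x : B \in P -> x \in B -> x \in W /\ x \notin A.
  by move=> BP xB; have := subsetP (PW B BP) x xB; rewrite inE => /andP[].
have disjA B : B \in P -> [disjoint A & B].
  move=> BP; rewrite disjoint_sym; apply/pred0P=> x /=; apply/negbTE/andP=> -[xB xA].
  by have [_] := disj B x BP xB; rewrite xA.
exists (A |: P); split.
- move=> C; rewrite !inE => /orP[/eqP->{C}|].
    split=> // B; rewrite !inE => /orP[/eqP->|BP _]; first by rewrite eqxx.
    split; first exact: disjA.
    have [/set0Pn[b bB] _ _] := mP B BP; have [bW bA] := disj B b BP bB.
    by have [[a aA eab] _] := dA b bW bA; exists a, b.
  move: C => B BP; have [B0 sB lB] := mP B BP; split=> // C.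
  rewrite !inE => /orP[/eqP-> _|]; last exact: lB.
  split; first by rewrite disjoint_sym disjA.
  have /set0Pn[b bB] := B0; have [bW bA] := disj B b BP bB.
  by have [_ [a aA eba]] := dA b bW bA; exists b, a.
- rewrite cardsU1 cP; case AP: (A \in P) => //.
  have /set0Pn[a aA] := A0.
  by have [_] := disj A a AP aA; rewrite aA.
- move=> B; rewrite !inE => /orP[/eqP-> //|/PW sB].
  exact: subset_trans sB (subsetDl _ _).
Qed.

(** Each core costs two colors and yields one branch set; for [r = 0] one
    color is enough, because any non-empty strong set is itself a branch set. *)
Lemma colorable_or_model r W : tournament_rel e ->
  colorable e (2 * r).+1 W \/ model_in r.+1 W.
Proof.
move=> te; elim: r W => [|r IHr] W; apply: colorable_strong_ind (@model_in_sub _) _ W.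
  move=> W sW W0; right; apply: (@model_in_add 0 W) => //.
    by move=> x ->.
  exists set0; split=> [A||A]; rewrite ?cards0 ?inE //.
move=> W sW W0; have [A [sAW A0 sA cA dA]] := dominating_core te sW W0.
have [cWA|mWA] := IHr (W :\: A); last by right; apply: model_in_add mWA.
left; have -> : W = A :|: W :\: A by rewrite setDE setUIr setUCr setIT (setUidPr sAW).
by rewrite mulnS -addnS; apply: colorable_setU.
Qed.
End ColoringOrModel.

(** * Transfer along maps and translation to digraphs *)
Section Transfer.
Variables (V V' : finType) (e : rel V) (e' : rel V') (h : V -> V').
Implicit Types (A U : {set V}) (B : {set V'}).

Lemma acyc_image A : (forall x y, e' (h x) (h y) -> e x y) ->
  acyc e A -> acyc e' (h @: A).
Proof.
move=> he acA U sUA /set0Pn[u uU].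
have [||x] := acA (A :&: h @^-1: U); first exact: subsetIl.
  have /imsetP[x xA ux] := subsetP sUA u uU.
  by apply/set0Pn; exists x; rewrite !inE xA -ux.
rewrite !inE => /andP[xA hxU] xmin; exists (h x) => // v vU.
have /imsetP[y yA vy] := subsetP sUA v vU; rewrite vy in vU *.
by apply: contra (xmin y _); [exact: he | rewrite !inE yA].
Qed.

Lemma acyc_preim B : (forall x y, e x y -> e' (h x) (h y)) ->
  acyc e' B -> acyc e (h @^-1: B).
Proof.
move=> he acB U sUB /set0Pn[u uU].
have [||y /imsetP[x xU ->] xmin] := acB (h @: U).
- apply/subsetP=> _ /imsetP[x xU ->].
  by have := subsetP sUB x xU; rewrite inE.
- by apply/set0Pn; exists (h u); apply: imset_f.
exists x => // v vU; apply: contra (xmin (h v) _); first exact: he.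
exact: imset_f.
Qed.

Lemma strong_image A : (forall x y, e x y -> e' (h x) (h y)) ->
  strong e A -> strong e' (h @: A).
Proof.
move=> he sA U sUA /set0Pn[u uU] /closed_inP cl.
suff sub : A \subset A :&: h @^-1: U.
  apply/subsetP=> _ /imsetP[x xA ->].
  by have := subsetP sub x xA; rewrite !inE => /andP[].
apply: sA; first exact: subsetIl.
  have /imsetP[x xA ux] := subsetP sUA u uU.
  by apply/set0Pn; exists x; rewrite !inE xA -ux.
apply/closed_inP=> x y; rewrite !inE => /andP[_ xU] yA /he exy.
by rewrite yA; apply: cl xU _ exy; apply: imset_f.
Qed.

Lemma strong_preim B : injective h -> (forall x y, e' (h x) (h y) -> e x y) ->
  B \subset codom h -> strong e' B -> strong e (h @^-1: B).
Proof.
move=> hI he sBh sB U sUB /set0Pn[u uU] /closed_inP cl.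
suff sub : B \subset h @: U.
  apply/subsetP=> x; rewrite inE => /(subsetP sub)/imsetP[y yU /hI->] //.
apply: sB.
- apply/subsetP=> _ /imsetP[x xU ->].
  by have := subsetP sUB x xU; rewrite inE.
- by apply/set0Pn; exists (h u); apply: imset_f.
apply/closed_inP=> _ y /imsetP[x xU ->] yB.
have /codomP[z yz] := subsetP sBh y yB; rewrite yz in yB *.
by move/he=> exz; apply/imset_f; apply: cl xU _ exz; rewrite inE.
Qed.

Lemma model_image (P : {set {set V}}) : injective h -> (forall x y, e x y -> e' (h x) (h y)) ->
  model e P -> model e' [set h @: A | A : {set V} in P].
Proof.
move=> hI he mP _ /imsetP[A AP ->]; have [/set0Pn[x xA] sA lnk] := mP A AP.
split; first by apply/set0Pn; exists (h x); apply: imset_f.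
  exact: strong_image.
move=> _ /imsetP[B BP ->] nAB.
have [|dis [u [v [uA vB euv]]]] := lnk B BP.
  by apply: contraNneq nAB => ->.
split; last by exists (h u), (h v); rewrite !imset_f ?he.
by rewrite -setI_eq0 -imsetI ?imset_eq0 ?setI_eq0 // => ? ? _ _; apply: hI.
Qed.

Lemma model_preim (P : {set {set V'}}) : injective h -> (forall x y, e' (h x) (h y) -> e x y) ->
  (forall B, B \in P -> B \subset codom h) ->
  model e' P -> model e [set h @^-1: B | B : {set V'} in P].
Proof.
move=> hI he sPh mP _ /imsetP[A AP ->]; have [/set0Pn[y yA] sA lnk] := mP A AP.
have hA := sPh A AP; split.
- have /codomP[x yx] := subsetP hA y yA.
  by apply/set0Pn; exists x; rewrite inE -yx.
- exact: strong_preim.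
move=> _ /imsetP[B BP ->] nAB.
have [|dis [u [v [uA vB euv]]]] := lnk B BP.
  by apply: contraNneq nAB => ->.
split; first by rewrite -setI_eq0 -preimsetI (disjoint_setI0 dis) preimset0.
have /codomP[x ux] := subsetP hA u uA.
have /codomP[z vz] := subsetP (sPh B BP) v vB.
by exists x, z; rewrite !inE -ux -vz; split=> //; apply: he; rewrite -ux -vz.
Qed.

Lemma card_preim_family (P : {set {set V'}}) :
  (forall B, B \in P -> B \subset codom h) ->
  #|[set h @^-1: B | B : {set V'} in P]| = #|P|.
Proof.
move=> sPh; apply: card_in_imset => A B AP BP eqAB.
have im C : C \in P -> h @: (h @^-1: C) = C.
  move=> CP; apply/setP=> y; apply/imsetP/idP=> [[x + ->]|yC].
    by rewrite inE.
  have /codomP[x yx] := subsetP (sPh C CP) y yC.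
  by exists x; rewrite ?inE -?yx.
by rewrite -(im A AP) eqAB im.
Qed.
End Transfer.


(** The predecessors along a cycle show that it has no source.  Conversely, in
    a set take a vertex u with the fewest ancestors: an in-neighbour v of u in the
    set would have the same ancestors as u, so u would reach v and the edge
    from v to u would close a cycle. *)
Lemma no_dicycle (D : digraph) : acyc (@edge D) setT <-> ~~ has_dicycle D.
Proof.
split=> [acD|nodi U _ /set0Pn[u0 u0U]].
  apply/existsP=> -[c /andP[c0 /andP[cyc _]]].
  have [|x] := acD [set x in c : seq D] (subsetT _).
    by case: (c : seq D) c0 => // x s _; apply/set0Pn; exists x; rewrite inE mem_head.
  rewrite inE => xc /(_ (prev c x)); rewrite inE mem_prev xc.
  by rewrite (prev_cycle cyc xc) => /(_ isT).
pose anc v := [set x | connect (@edge D) x v].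
case: (arg_minnP (fun v => #|anc v|) u0U) => u; rewrite -[_ u]/(u \in U) => uU umin.
exists u => // v vU; apply: contra nodi => evu.
have sub : anc v \subset anc u.
  apply/subsetP=> x; rewrite !inE => xv.
  exact: connect_trans xv (connect1 evu).
have : u \in anc v.
  have /eqP-> : anc v == anc u by rewrite eqEcard sub umin.
  by rewrite inE.
rewrite inE => /connectP[p0 pp0]; case/shortenP: pp0 => p pp up _ vp.
have szp : size (u :: p) <= #|D|.
  by rewrite -(card_uniqP up) max_card.
apply/existsP; exists (Bseq szp); apply/andP; split=> //.
by rewrite /ucycleb up andbT /= rcons_path pp -vp.
Qed.

Lemma strongly_connectedP (D : digraph) : strong (@edge D) setT <-> strongly_connected D.
Proof.
split=> [sD|sD U _ /set0Pn[u uU] /closed_inP cl].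
  apply/forallP=> u; apply/forallP=> v.
  have /subsetP/(_ v) : [set: D] \subset [set v | connect (@edge D) u v].
    apply: sD; rewrite ?subsetT //; first by apply/set0Pn; exists u; rewrite inE.
    apply/closed_inP=> x y; rewrite !inE => ux _ exy.
    exact: connect_trans ux (connect1 exy).
  by rewrite !inE => ->.
apply/subsetP=> v _; have /forallP/(_ u)/forallP/(_ v)/connectP[p pp ->] := sD.
elim: p u uU pp => //= x p IHp u uU /andP[eux pp].
by apply: IHp pp; apply: cl eux.
Qed.

Lemma acyclicP (D : digraph) (A : {set D}) : acyc (@edge D) A <-> acyclic A.
Proof.
split=> [acA|/no_dicycle acA].
  apply/no_dicycle.
  have -> : [set: induced A] = val @^-1: A.
    by apply/setP=> x; rewrite !inE (valP x).
  by apply: acyc_preim acA => x y /andP[].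
have -> : A = val @: [set: induced A].
  apply/setP=> x; apply/idP/imsetP=> [xA|[y _ ->]]; last exact: valP.
  by exists (Sub x xA).
by apply: acyc_image acA => x y exy; rewrite /= /sub_edge exy inE.
Qed.

Lemma strong_induced (D : digraph) (A : {set D}) :
  strong (@edge D) A <-> strongly_connected (induced A).
Proof.
split=> [sA|/strongly_connectedP sA].
  apply/strongly_connectedP.
  have -> : [set: induced A] = val @^-1: A.
    by apply/setP=> x; rewrite !inE (valP x).
  apply: strong_preim sA => [|x y exy|].
  - exact: val_inj.
  - by rewrite /= /sub_edge exy inE.
  - by apply/subsetP=> x xA; apply/codomP; exists (Sub x xA).
have -> : A = val @: [set: induced A].
  apply/setP=> x; apply/idP/imsetP=> [xA|[y _ ->]]; last exact: valP.
  by exists (Sub x xA).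
by apply: strong_image sA => x y /andP[].
Qed.

Section Digraphs.
Variable D : digraph.

Lemma dichromatic_le k : colorable (@edge D) k setT -> dichromatic D <= k.
Proof.
move=> [c ck ac]; pose P := preim_partition c [set: D].
rewrite /dichromatic; case: ex_minnP => m _ mmin.
apply: (@leq_trans #|P|).
  apply: mmin; apply/existsP; exists P; rewrite eqxx andbT.
  apply/andP; split; first exact: preim_partitionP.
  apply/forall_inP=> _ /imsetP[v _ ->]; apply/acyclicP.
  apply: acyc_sub (ac (c v)); apply/subsetP=> x.
  by rewrite !inE eq_sym.
rewrite -[k]card_ord.
have sub : P \subset [set [set v | c v == i] | i : 'I_k].
  apply/subsetP=> _ /imsetP[v _ ->]; apply/imsetP.
  exists (Ordinal (ck v (in_setT v))) => //.
  by apply/setP=> x; rewrite !inE eq_sym.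
by apply: leq_trans (subset_leq_card sub) (leq_imset_card _ _).
Qed.

(** The color of a vertex is the position of its block in an enumeration of an
    optimal partition. *)
Lemma colorable_dichromatic : colorable (@edge D) (dichromatic D) setT.
Proof.
rewrite /dichromatic; case: ex_minnP => m + _.
case/existsP=> P /andP[/andP[partP /forall_inP acP] /eqP<-].
have vP v : pblock P v \in P.
  by apply: pblock_mem; rewrite (cover_partition partP) inE.
exists (fun v => index (pblock P v) (enum P)) => [v _|n].
  by rewrite cardE index_mem mem_enum.
apply: (@acyc_sub _ _ _ (nth set0 (enum P) n)).
  apply/subsetP=> v; rewrite inE => /andP[_ /eqP<-].
  rewrite nth_index ?mem_enum // mem_pblock (cover_partition partP) inE //.
case: (ltnP n (size (enum P))) => [ln|/(nth_default set0)->].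
  by apply/acyclicP/acP; rewrite -mem_enum mem_nth.
by move=> U; rewrite subset0 => ->.
Qed.

Lemma minor_model r : has_strong_minor D r ->
  exists2 P : {set {set D}}, model (@edge D) P & #|P| = r.
Proof.
case/existsP=> W /existsP[F /existsP[P /and4P[partP /eqP cP /forall_inP sP /forall_inP lP]]].
have mP : model (@edge (subdigraph W F)) P.
  move=> A AP; split.
  - by apply: contraTneq AP => ->; case/and3P: partP.
  - exact/strong_induced/sP.
  move=> B BP nAB; split.
    by case/and3P: partP => _ /trivIsetP/(_ A B AP BP nAB).
  have /forall_inP/(_ B BP)/implyP/(_ nAB)/exists_inP[u uA /exists_inP[v vB euv]] := lP A AP.
  by exists u, v.
exists [set val @: A | A : {set subdigraph W F} in P].
  by apply: model_image mP => [|x y /andP[]//]; exact: val_inj.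
by rewrite card_imset //; apply: imset_inj; exact: val_inj.
Qed.

Lemma model_minor (P : {set {set D}}) : model (@edge D) P -> has_strong_minor D #|P|.
Proof.
move=> mP; apply/existsP; exists (cover P); apply/existsP; exists setT.
pose S := subdigraph (cover P) [set: D * D].
pose h : S -> D := val.
have hP B : B \in P -> B \subset codom h.
  move=> BP; apply/subsetP=> x xB.
  have xc : x \in cover P by apply/bigcupP; exists B.
  by apply/codomP; exists (Sub x xc).
have he (x y : S) : edge (h x) (h y) -> edge x y.
  by move=> exy; rewrite /= /sub_edge exy inE.
have mQ := model_preim (@val_inj _ _ _ : injective h) he hP mP.
have cQ := card_preim_family hP.
set Q := [set _ | _ in _] in mQ cQ; apply/existsP; exists Q; apply/and4P; split.
- apply/and3P; split.
  + rewrite eqEsubset subsetT; apply/subsetP=> x _.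
    have /bigcupP[B BP xB] := valP x.
    by apply/bigcupP; exists (h @^-1: B); [apply: imset_f | rewrite inE].
  + by apply/trivIsetP=> A B AQ BQ nAB; have [_ _ /(_ B BQ nAB)[]] := mQ A AQ.
  + by apply/negP=> /mQ[]; rewrite eqxx.
- exact/eqP.
- by apply/forall_inP=> A /mQ[_ sA _]; apply/strong_induced.
- apply/forall_inP=> A AQ; apply/forall_inP=> B BQ; apply/implyP=> nAB.
  have [_ _ /(_ B BQ nAB)[_ [u [v [uA vB euv]]]]] := mQ A AQ.
  by apply/exists_inP; exists u => //; apply/exists_inP; exists v.
Qed.

Lemma sm_ge (P : {set {set D}}) : model (@edge D) P -> #|P| <= sm D.
Proof. by move=> /model_minor; rewrite /sm; case: ex_maxnP => m _; apply. Qed.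

Lemma sm_le k : (forall P : {set {set D}}, model (@edge D) P -> #|P| <= k) -> sm D <= k.
Proof.
by move=> Pk; rewrite /sm; case: ex_maxnP => m /minor_model[P /Pk + <-] _.
Qed.
End Digraphs.

(** * Towers of directed triangles *)
Definition triangle_edge (D : digraph) : rel (option (D + D)) := fun x y =>
  match x, y with
  | None, Some (inl _) => true
  | Some (inl _), Some (inr _) => true
  | Some (inr _), None => true
  | Some (inl a), Some (inl b) => edge a b
  | Some (inr a), Some (inr b) => edge a b
  | _, _ => false
  end.

Lemma triangle_irr (D : digraph) : irreflexive (@triangle_edge D).
Proof. by case=> [[a|a]|] //=; rewrite edge_irr. Qed.

(** The directed triangle with two vertices blown up into copies of [D]; [None] is the apex. *)
Definition triangle (D : digraph) : digraph := Digraph (@triangle_irr D).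

Lemma point_irr : irreflexive (fun _ _ : unit => false).
Proof. by []. Qed.

Definition point : digraph := Digraph point_irr.

Definition tower n : digraph := iter n triangle point.

Section Triangle.
Variable D : digraph.
Let T : digraph := triangle D.
Let inL (a : D) : T := Some (inl a).
Let inR (a : D) : T := Some (inr a).

Let inL_inj : injective inL. Proof. by move=> a b []. Qed.
Let inR_inj : injective inR. Proof. by move=> a b []. Qed.

Lemma tournament_triangle : tournament D -> tournament T.
Proof.
move=> tD [[a|a]|] [[b|b]|] //= nab; apply: tD.
  by apply: contraNneq nab => ->.
by apply: contraNneq nab => ->.
Qed.

Lemma colorable_triangle k : colorable (@edge D) k setT -> colorable (@edge T) k.+1 setT.
Proof.
move=> [c ck ac].
exists (fun x : T => match x with Some (inl a) | Some (inr a) => c a | None => k end).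
  by case=> [[a|a]|] _ //; apply/ltnW; rewrite ltnS ck.
move=> n; have [nk|nk] := eqVneq n k.
  apply: acyc_sub (@acyc1 _ _ (None : T) (@edge_irr T)).
  apply/subsetP=> -[[a|a]|]; rewrite !inE //= nk => /eqP ca.
    by have := ck a (in_setT a); rewrite ca ltnn.
  by have := ck a (in_setT a); rewrite ca ltnn.
pose C := [set a in [set: D] | c a == n].
apply: (@acyc_sub _ _ _ (inR @: C :|: inL @: C)).
  apply/subsetP=> -[[a|a]|]; rewrite !inE /= => ca.
  - by rewrite [X in _ || X]imset_f ?orbT // !inE.
  - by rewrite imset_f // !inE.
  - by rewrite eq_sym (negPf nk) in ca.
apply: acyc_setU.
- by move=> _ _ /imsetP[a _ ->] /imsetP[b _ ->].
- by apply: acyc_image (ac n).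
- by apply: acyc_image (ac n).
Qed.

(** The color of the apex is missing from one copy of [D], because vertices of
    that color in both copies would form a monochromatic triangle with the
    apex.  In that copy the freed color replaces color [k]. *)
Lemma triangle_colorable k : colorable (@edge T) k.+1 setT -> colorable (@edge D) k setT.
Proof.
move=> [c ck ac]; set n0 := c None.
have recol (h : D -> T) : (forall a b, edge a b -> edge (h a) (h b)) ->
    (forall a, c (h a) != n0) -> colorable (@edge D) k setT.
  move=> he hn0; exists (fun a => if c (h a) == k then n0 else c (h a)) => [a _|n].
    have ca := ck (h a) (in_setT _); have c0 : n0 < k.+1 := ck None (in_setT _).
    have := hn0 a; case: (c (h a) =P k) => [->|/eqP nk]; last first.
      by move=> _; rewrite ltn_neqAle nk -ltnS.
    by move=> kn0; rewrite ltn_neqAle eq_sym kn0 -ltnS.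
  pose m := if n == n0 then k else n.
  apply: acyc_sub (acyc_preim he (ac m)); apply/subsetP=> a; rewrite !inE /=.
  rewrite /m; case: ifP => [cak|cak] /eqP<-; first by rewrite eqxx.
  by rewrite (negPf (hn0 a)).
have [/existsP[a /eqP ca]|] := boolP [exists a, c (inL a) == n0]; last first.
  rewrite negb_exists => /forallP; exact: recol.
have [/existsP[b /eqP cb]|] := boolP [exists b, c (inR b) == n0]; last first.
  rewrite negb_exists => /forallP; exact: recol.
have [||x] := ac n0 [set None; inL a; inR b].
- by apply/subsetP=> x; rewrite !inE -orbA => /or3P[]/eqP->; rewrite ?ca ?cb eqxx.
- by apply/set0Pn; exists None; rewrite !inE.
rewrite !inE -orbA => /or3P[]/eqP-> src.
- by have := src (inR b); rewrite !inE eqxx orbT => /(_ isT).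
- by have := src None; rewrite !inE => /(_ isT).
- by have := src (inL a); rewrite !inE eqxx => /(_ isT).
Qed.

(** Edges leave the second copy only towards the apex, so the part of [A] in the
    second copy is closed in [A]. *)
Lemma strong_side (A : {set T}) : strong (@edge T) A -> None \notin A ->
  A \subset codom inL \/ A \subset codom inR.
Proof.
move=> sA AN; have [R0|R0] := eqVneq (A :&: [set x in codom inR]) set0.
  left; apply/subsetP=> -[[a|a]|] xA; last by rewrite xA in AN.
    exact: codom_f.
  by have := in_set0 (inR a); rewrite -R0 !inE xA codom_f.
right; apply: subset_trans (sA _ (subsetIl _ _) R0 _) _; last first.
  by apply/subsetP=> x; rewrite !inE => /andP[].
apply/closed_inP=> u v; rewrite !inE => /andP[_ /codomP[a ->]].
case: v => [[b|b]|] vA //= _.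
  by rewrite vA codom_f.
by rewrite vA in AN.
Qed.

(** Disjointness leaves at most one branch set containing the apex; all others
    lie in the same copy, as no edge goes back from the second copy to the
    first. *)
Lemma model_triangle k :
    (forall P : {set {set D}}, model (@edge D) P -> #|P| <= k) ->
  forall P : {set {set T}}, model (@edge T) P -> #|P| <= k.+1.
Proof.
move=> Dk P mP; pose Q := [set A in P | None \notin A].
have QP A : A \in Q -> A \in P by rewrite inE => /andP[].
have mQ : model (@edge T) Q.
  move=> A /QP/mP[A0 sA lA]; split=> // B /QP; exact: lA.
have Qk : #|Q| <= k.
  have side (h : D -> T) : injective h ->
      (forall x y, edge (h x) (h y) -> edge x y) ->
      (forall A, A \in Q -> A \subset codom h) -> #|Q| <= k.
    move=> hI he hQ; rewrite -(card_preim_family hQ).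
    exact: Dk (model_preim hI he hQ mQ).
  have [/exists_inP[A AQ AR]|] := boolP [exists A in Q, ~~ (A \subset codom inL)].
    apply: (side inR) => // B BQ; have [_ sB lB] := mQ B BQ.
    have NB : None \notin B by move: BQ; rewrite inE => /andP[].
    have [BL|//] := strong_side sB NB.
    have nBA : B != A by apply: contraNneq AR => <-.
    have [A0 sA lA] := mQ A AQ.
    have NA : None \notin A by move: AQ; rewrite inE => /andP[].
    have [AL|{}AR] := strong_side sA NA; first by rewrite AL in AR.
    have [|_ [u [v [uA vB]]]] := lA B BQ; first by rewrite eq_sym.
    have /codomP[a ->] := subsetP AR u uA.
    by have /codomP[b ->] := subsetP BL v vB.
  rewrite negb_exists_in => /forall_inP QL.
  by apply: (side inL) => // A /QL; rewrite negbK.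
rewrite -(cardsID [set A : {set T} | None \in A] P) addnC -addn1 leq_add //.
  by apply: leq_trans Qk; apply: subset_leq_card; apply/subsetP=> A; rewrite !inE andbC.
rewrite leqNgt; apply/negP=> /card_gt1P[A [B]].
rewrite !inE => -[/andP[AP NA] /andP[BP NB] nAB].
have [_ _ /(_ B BP nAB)[dAB _]] := mP A AP.
by have := disjointFr dAB NA; rewrite NB.
Qed.
End Triangle.

(** A branch set avoiding the apex is a single vertex; the edges linking it both
    ways force the other branch set to contain the two remaining vertices,
    which are not strongly connected. *)
Lemma model_three_cycle (P : {set {set triangle point}}) :
  model (@edge (triangle point)) P -> #|P| <= 1.
Proof.
move=> mP; rewrite leqNgt; apply/negP=> /card_gt1P[A [B [AP BP nAB]]].
wlog NA : A B AP BP nAB / None \notin A.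
  move=> H; have [NA|] := boolP (None \in A); last exact: H nAB.
  have [_ _ /(_ B BP nAB)[dAB _]] := mP A AP.
  by apply: (H B A) => //; rewrite 1?eq_sym // (disjointFr dAB).
have [A0 sA /(_ B BP nAB)[dAB [u [v [uA vB euv]]]]] := mP A AP.
have [B0 sB /(_ A AP)] := mP B BP; rewrite eq_sym => /(_ nAB)[_ [x [y [xB yA exy]]]].
have notin z : z \in A -> z \in B -> False.
  by move=> zA; rewrite (disjointFr dAB zA).
have [/subsetP AL|/subsetP AR] := strong_side sA NA.
- have /codomP[[] uE] := AL u uA; have /codomP[[] yE] := AL y yA.
  have vE : v = Some (inr tt) by case: v uE euv {vB} => [[[]|[]]|] ->.
  have xE : x = None by case: x exy {xB} => [[[]|[]]|]; rewrite yE.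
  rewrite xE in xB; have: B \subset [set None].
    apply: sB; rewrite ?sub1set //; first by apply/set0Pn; exists None; rewrite inE.
    apply/closed_inP=> _ z /set1P-> zB; case: z zB => [[[]|[]]|] // zB _.
    by case: (notin y yA); rewrite yE.
  by move/subsetP/(_ v vB); rewrite vE inE.
- have /codomP[[] uE] := AR u uA; have /codomP[[] yE] := AR y yA.
  have vE : v = None by case: v euv {vB} => [[[]|[]]|]; rewrite uE.
  have xE : x = Some (inl tt) by case: x exy {xB} => [[[]|[]]|]; rewrite yE.
  rewrite xE in xB; have: B \subset [set Some (inl tt)].
    apply: sB; rewrite ?sub1set //.
      by apply/set0Pn; exists (Some (inl tt)); rewrite inE.
    apply/closed_inP=> _ z /set1P-> zB; case: z zB => [[[]|[]]|] // zB _.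
    by case: (notin y yA); rewrite yE.
  by move/subsetP/(_ v vB); rewrite vE inE.
Qed.

Theorem theorem1p2 :
  (forall (r : nat) (T : digraph),
     1 <= r -> tournament T -> 2 * r <= dichromatic T -> r <= sm T) /\
  (forall r : nat, 2 <= r ->
     exists S : digraph,
       [/\ tournament S, dichromatic S = r & sm S <= r - 1]).
Proof.
split=> [[//|r] T _ tT chiT|[//|[//|r]] _].
  have [/dichromatic_le chi|[P [mP <- _]]] :=
    colorable_or_model r [set: T] (conj (@edge_irr T) tT); last exact: sm_ge.
  by have := leq_trans chiT chi; rewrite mulnS ltnn.
exists (tower r.+1); split.
- by elim: r.+1 => [[] []|n IHn] //; apply: tournament_triangle.
- apply/eqP; rewrite eqn_leq; apply/andP; split.
    apply: dichromatic_le; elim: r.+1 => [|n IHn]; last exact: colorable_triangle.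
    exists (fun=> 0) => // n; apply: acyc_sub (@acyc1 _ _ (tt : point) (@edge_irr point)).
    by apply/subsetP=> -[]; rewrite !inE.
  rewrite ltnNge; apply/negP=> chi.
  have: colorable (@edge (tower r.+1)) r.+1 setT.
    have [c ck ac] := colorable_dichromatic (tower r.+1).
    by exists c => // v vT; apply: leq_trans (ck v vT) chi.
  elim: r.+1 => [[c /(_ tt (in_setT _))]|n IHn] // /triangle_colorable; exact: IHn.
rewrite subn1; apply: sm_le.
elim: r => [|n IHn]; [exact: model_three_cycle | exact: model_triangle].
Qed.
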